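(* Let $\omega\in\mathcal{B}'_0$ with $\omega(z)=c_1z+c_2z^2+c_3z^3+c_4z^4+\cdots$. Then $$|c_4-c_2^2|\le\frac14(1-|c_1|^2),$$ and the estimate is sharp for every value of $|c_1|\in[0,1]$: equality is attained by the function $$\omega(z)=\int_0^z\frac{|c_1|+\zeta^3}{1+|c_1|\zeta^3}\,d\zeta=|c_1|z+\frac14(1-|c_1|^2)z^4-\frac17|c_1|(1-|c_1|^2)z^7+\cdots,$$ which belongs to $\mathcal{B}'_0$.
   Context: Let $\mathbb{D}=\{z\in\mathbb{C}:|z|<1\}$. The class $\mathcal{B}'_0$ consists of all functions $\omega$ analytic in $\mathbb{D}$ of the form $\omega(z)=c_1z+c_2z^2+c_3z^3+\cdots$ (with $c_1,c_2,\ldots\in\mathbb{C}$, so $\omega(0)=0$) such that $|\omega'(z)|\le1$ for all $z\in\mathbb{D}$. *)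

(* Defs.v *)
From Stdlib Require Import Reals.
From Coquelicot Require Import Coquelicot.

Open Scope R_scope.

Definition unit_disc (z : C) : Prop := Cmod z < 1.

(* Complex differentiability: the base ring of [ex_derive] is C, not R. *)
Definition analytic_in_disc (f : C -> C) : Prop :=
  forall z : C, unit_disc z ->
    ex_derive (K := C_AbsRing) (V := C_NormedModule) f z.

(* [f z = c_1 z + c_2 z^2 + ...] on the whole open disc; [c] is indexed from 0,
   hence the requirement [c 0 = 0]. *)
Definition has_expansion (f : C -> C) (c : nat -> C) : Prop :=
  c 0%nat = RtoC 0 /\
  forall z : C, unit_disc z ->
    is_pseries (K := C_AbsRing) (V := C_NormedModule) c z (f z).

(* [C_derive] is a total operator computed from a limit in the real direction;
   it is the complex derivative as soon as [ex_derive] holds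
   ([C_derive_correct]), which [analytic_in_disc] provides on the disc. *)
Definition class_B0' (f : C -> C) : Prop :=
  analytic_in_disc f /\
  (exists c : nat -> C, has_expansion f c) /\
  (forall z : C, unit_disc z -> Cmod (C_derive f z) <= 1).

(* Integral of [f] along the segment from 0 to [z], parametrized by
   [zeta = t z] for [t] in [0, 1]. *)
Definition segment_integral (f : C -> C) (z : C) : C :=
  RInt (V := C_R_CompleteNormedModule)
    (fun t : R => Cmult (f (Cmult (RtoC t) z)) z) 0 1.

Definition extremal (a : R) (z : C) : C :=
  segment_integral
    (fun zeta : C => ((a + zeta ^ 3) / (1 + a * zeta ^ 3))%C) z.

(* Main.v *)
Require Import Defs.
From Stdlib Require Import Reals Lra Lia.
From Coquelicot Require Import Coquelicot.

(** Write [f] for the derivative of [omega] and [b_n = (n + 1) c_(n+1)] for its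
    Taylor coefficients, so that [|f| <= 1] on the disc.  The whole inequality
    follows from

      [|b_3| + |b_0|^2 + |b_1|^2 <= 1],

    that is, [4 |c_4| + |c_1|^2 + 4 |c_2|^2 <= 1], and the triangle inequality.

    To see why this holds, multiply [f] by the test polynomial
    [p = 1 + mu (conj b_1 z^2 + conj b_0 z^3)] with [|mu| = 1].  The product [f p]
    has coefficients [b_0], [b_1] and [b_3 + mu q] at [1], [z] and [z^3], where
    [q = |b_0|^2 + |b_1|^2].  Since [|f p| <= |p|] on the disc, Parseval gives
    [q + |b_3 + mu q|^2 <= 1 + q]; choosing for [mu] the phase of [b_3] turns this
    into [|b_3| + q <= 1].

    Parseval is only needed for polynomials, where averaging over the [N]-th roots
    of unity replaces the integral over the circle ([parseval],
    [bounded_poly_coeffs]).  A partial sum of [f] on the circle of radius [r < 1]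
    is bounded by [1 + eps], and letting [eps] tend to 0 and [r] to 1 gives the
    inequality for [f] itself ([bounded_function_coeffs]).

    Both halves of the theorem rely on termwise differentiation of complex power
    series ([is_Cderive_pseries]): it identifies the coefficients of the
    derivative of [omega], and, for the extremal function, it provides a primitive
    of the integrand, so that the fundamental theorem of calculus along a segment
    yields the expansion of the integral ([extremal_expansion]).  The extremal
    function satisfies [|omega'| <= 1] because
    [|1 + a w|^2 - |a + w|^2 = (1 - a^2) (1 - |w|^2)] is nonnegative for
    [w = z^3]. *)

Open Scope R_scope.

(** * Finite sums of complex numbers *)

Fixpoint csum (f : nat -> C) (N : nat) : C :=
  match N with
  | O => RtoC 0
  | S n => (csum f n + f n)%C
  end.

Lemma csum_ext (f g : nat -> C) (N : nat) :
  (forall k, (k < N)%nat -> f k = g k) -> csum f N = csum g N.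
Proof.
  induction N as [|N IH]; intros H; simpl; [reflexivity|].
  rewrite IH by (intros; apply H; lia). now rewrite H by lia.
Qed.

Lemma csum_plus (f g : nat -> C) (N : nat) :
  csum (fun k => (f k + g k)%C) N = (csum f N + csum g N)%C.
Proof. induction N as [|N IH]; simpl; [|rewrite IH]; ring. Qed.

Lemma csum_scal (x : C) (f : nat -> C) (N : nat) :
  csum (fun k => (x * f k)%C) N = (x * csum f N)%C.
Proof. induction N as [|N IH]; simpl; [|rewrite IH]; ring. Qed.

Lemma csum_zero (f : nat -> C) (N : nat) :
  (forall k, (k < N)%nat -> f k = RtoC 0) -> csum f N = RtoC 0.
Proof.
  induction N as [|N IH]; intros H; simpl; [reflexivity|].
  rewrite IH by (intros; apply H; lia). rewrite H by lia. ring.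
Qed.

Lemma csum_swap (f : nat -> nat -> C) (M N : nat) :
  csum (fun i => csum (fun j => f i j) N) M =
  csum (fun j => csum (fun i => f i j) M) N.
Proof.
  induction M as [|M IH]; simpl.
  - symmetry. now apply csum_zero.
  - now rewrite IH, csum_plus.
Qed.

Lemma csum_conj (f : nat -> C) (N : nat) :
  Cconj (csum f N) = csum (fun k => Cconj (f k)) N.
Proof.
  induction N as [|N IH]; simpl.
  - apply injective_projections; simpl; ring.
  - now rewrite Cplus_conj, IH.
Qed.

Lemma csum_single (f : nat -> C) (N i : nat) :
  (i < N)%nat -> (forall k, (k < N)%nat -> k <> i -> f k = RtoC 0) ->
  csum f N = f i.
Proof.
  induction N as [|N IH]; intros Hi H; [lia|]; simpl.
  destruct (Nat.eq_dec i N) as [->|Hne].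
  - rewrite csum_zero; [ring|]. intros; apply H; lia.
  - rewrite IH by (try (intros; apply H); lia). rewrite (H N) by lia. ring.
Qed.

Lemma csum_mult (f g : nat -> C) (M N : nat) :
  (csum f M * csum g N)%C = csum (fun i => csum (fun j => (f i * g j)%C) N) M.
Proof.
  induction M as [|M IH]; simpl; [ring|].
  rewrite <- IH, csum_scal. ring.
Qed.

Lemma csum_geom (q : C) (N : nat) :
  ((q - 1) * csum (fun k => (q ^ k)%C) N = q ^ N - 1)%C.
Proof.
  induction N as [|N IH]; simpl; [ring|].
  replace ((q - 1) * (csum (fun k => q ^ k) N + q ^ N))%C
    with ((q - 1) * csum (fun k => q ^ k) N + (q - 1) * q ^ N)%C by ring.
  rewrite IH. ring.
Qed.

(** * Roots of unity and Parseval for polynomials *)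

Definition root_unity (N : nat) : C :=
  (cos (2 * PI / INR N), sin (2 * PI / INR N)).

Lemma root_unity_pow (N m : nat) :
  (root_unity N ^ m)%C =
  (cos (INR m * (2 * PI / INR N)), sin (INR m * (2 * PI / INR N))).
Proof.
  induction m as [|m IH].
  - simpl. rewrite Rmult_0_l, cos_0, sin_0. reflexivity.
  - rewrite Cpow_S, IH, S_INR, Rmult_plus_distr_r, Rmult_1_l, cos_plus, sin_plus.
    unfold root_unity, Cmult; simpl. f_equal; ring.
Qed.

Lemma root_unity_pow_order (N : nat) :
  (0 < N)%nat -> (root_unity N ^ N)%C = RtoC 1.
Proof.
  intros HN. rewrite root_unity_pow.
  replace (INR N * (2 * PI / INR N)) with (2 * PI).
  - now rewrite cos_2PI, sin_2PI.
  - field. apply not_0_INR. lia.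
Qed.

(** Half angles: [cos (2 x) = 1 - 2 (sin x)^2], and [sin x > 0] for [0 < x < PI]. *)
Lemma root_unity_primitive (N m : nat) :
  (0 < m < N)%nat -> (root_unity N ^ m)%C <> RtoC 1.
Proof.
  intros Hm E. rewrite root_unity_pow in E.
  apply (f_equal fst) in E; simpl in E.
  set (x := INR m * (PI / INR N)).
  replace (INR m * (2 * PI / INR N)) with (2 * x) in E
    by (unfold x, Rdiv; ring).
  assert (HN : 0 < INR N) by (apply lt_0_INR; lia).
  assert (H0 : 0 < INR m) by (apply lt_0_INR; lia).
  assert (H1 : INR m < INR N) by (apply lt_INR; lia).
  assert (HP := PI_RGT_0).
  assert (Hs : 0 < sin x).
  { assert (Hx : x = INR m / INR N * PI) by (unfold x; field; lra).
    assert (Hq : INR m / INR N < 1).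
    { apply (Rmult_lt_reg_r (INR N)); [lra|].
      unfold Rdiv. rewrite Rmult_assoc, Rinv_l by lra. lra. }
    assert (Hq0 : 0 < INR m / INR N) by (apply Rdiv_lt_0_compat; lra).
    apply sin_gt_0; rewrite Hx; nra. }
  rewrite cos_2a_sin in E. nra.
Qed.

Lemma Cmod_root_unity (N : nat) : Cmod (root_unity N) = 1.
Proof.
  unfold Cmod, root_unity; simpl fst; simpl snd.
  rewrite <- sqrt_1. f_equal.
  assert (H := sin2_cos2 (2 * PI / INR N)). unfold Rsqr in H. lra.
Qed.

Lemma Cmult_conj_unit (z : C) : Cmod z = 1 -> (z * Cconj z)%C = RtoC 1.
Proof. intros H. rewrite <- Cmod2_conj, H. simpl. f_equal; ring. Qed.

Lemma unit_pow_conj (z : C) (j m : nat) :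
  Cmod z = 1 -> (z ^ (j + m) * Cconj (z ^ j))%C = (z ^ m)%C.
Proof.
  intros H. rewrite Cpow_add_r.
  replace (z ^ j * z ^ m * Cconj (z ^ j))%C
    with (z ^ m * (z ^ j * Cconj (z ^ j)))%C by ring.
  rewrite Cmult_conj_unit; [ring|]. now rewrite Cmod_pow, H, pow1.
Qed.

Lemma csum_root_unity_pow (N m : nat) :
  (0 < m < N)%nat ->
  csum (fun k => ((root_unity N ^ k) ^ m)%C) N = RtoC 0.
Proof.
  intros Hm.
  assert (Hne : (root_unity N ^ m - 1)%C <> RtoC 0).
  { intros E. apply (root_unity_primitive N m Hm).
    replace (root_unity N ^ m)%C with ((root_unity N ^ m - 1) + 1)%C by ring.
    rewrite E. ring. }
  rewrite (csum_ext _ (fun k => ((root_unity N ^ m) ^ k)%C)).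
  2: { intros k _. rewrite <- !Cpow_mult_r. f_equal. lia. }
  assert (G := csum_geom (root_unity N ^ m)%C N).
  rewrite <- Cpow_mult_r, (Nat.mul_comm m N), Cpow_mult_r in G.
  rewrite root_unity_pow_order, Cpow_1_l in G by lia.
  replace (1 - 1)%C with (RtoC 0) in G by ring.
  set (s := csum _ N) in *.
  replace s with (/ (root_unity N ^ m - 1) * ((root_unity N ^ m - 1) * s))%C
    by (field; exact Hne).
  rewrite G. ring.
Qed.

Lemma csum_const (x : C) (N : nat) : csum (fun _ => x) N = (INR N * x)%C.
Proof.
  induction N as [|N IH].
  - simpl. ring.
  - rewrite S_INR, RtoC_plus. simpl csum. rewrite IH. ring.
Qed.

(** Discrete orthogonality of the monomials on the unit circle: on it [conj z] is
    the inverse of [z], so each product is a power of [z] or of [conj z], and for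
    distinct exponents its values form a geometric progression with sum 0. *)
Lemma root_unity_orthogonal (N i j : nat) :
  (i < N)%nat -> (j < N)%nat ->
  csum (fun k => ((root_unity N ^ k) ^ i * Cconj ((root_unity N ^ k) ^ j))%C) N =
  if Nat.eq_dec i j then RtoC (INR N) else RtoC 0.
Proof.
  intros Hi Hj.
  assert (U : forall k, Cmod (root_unity N ^ k) = 1)
    by (intros k; now rewrite Cmod_pow, Cmod_root_unity, pow1).
  destruct (Nat.eq_dec i j) as [<-|Hne].
  - rewrite (csum_ext _ (fun _ => RtoC 1)).
    + rewrite csum_const. ring.
    + intros k _. apply Cmult_conj_unit. now rewrite Cmod_pow, U, pow1.
  - destruct (Nat.lt_ge_cases j i) as [Hlt|Hge].
    + rewrite (csum_ext _ (fun k => ((root_unity N ^ k) ^ (i - j))%C)).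
      * apply csum_root_unity_pow. lia.
      * intros k _. rewrite <- (unit_pow_conj _ j (i - j) (U k)).
        do 3 f_equal. lia.
    + rewrite (csum_ext _ (fun k => Cconj ((root_unity N ^ k) ^ (j - i))%C)).
      * rewrite <- csum_conj, csum_root_unity_pow by lia.
        apply injective_projections; simpl; ring.
      * intros k _. rewrite <- (unit_pow_conj _ i (j - i) (U k)).
        rewrite Cmult_conj, Cconj_conj, Cmult_comm. do 3 f_equal. lia.
Qed.

Fixpoint rsum (f : nat -> R) (N : nat) : R :=
  match N with
  | O => 0
  | S n => rsum f n + f n
  end.

Lemma csum_RtoC (f : nat -> R) (N : nat) :
  csum (fun k => RtoC (f k)) N = RtoC (rsum f N).
Proof. induction N as [|N IH]; simpl; [|rewrite IH, RtoC_plus]; reflexivity. Qed.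

Definition poly_sum (a : nat -> C) (N : nat) (z : C) : C :=
  csum (fun n => (a n * z ^ n)%C) N.

(** The number of nodes equals the number of coefficients, so no two monomials
    coincide on the nodes and the identity is exact. *)
Lemma parseval (a : nat -> C) (N : nat) :
  rsum (fun k => Cmod (poly_sum a N (root_unity N ^ k)) ^ 2) N =
  INR N * rsum (fun n => Cmod (a n) ^ 2) N.
Proof.
  apply RtoC_inj. rewrite RtoC_mult, <- !csum_RtoC.
  set (w := root_unity N).
  transitivity (csum (fun k => csum (fun i => csum (fun j =>
     (a i * Cconj (a j)) * ((w ^ k) ^ i * Cconj ((w ^ k) ^ j)))%C N) N) N).
  { apply csum_ext; intros k _. rewrite Cmod2_conj.
    unfold poly_sum at 2. rewrite csum_conj. unfold poly_sum.
    rewrite csum_mult. apply csum_ext; intros i _.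
    apply csum_ext; intros j _. rewrite Cmult_conj. ring. }
  rewrite csum_swap, <- csum_scal. apply csum_ext; intros i Hi.
  rewrite csum_swap.
  rewrite (csum_single _ _ i Hi).
  - rewrite csum_scal. unfold w. rewrite root_unity_orthogonal by assumption.
    destruct (Nat.eq_dec i i); [|easy]. rewrite Cmod2_conj. ring.
  - intros j Hj Hne. rewrite csum_scal. unfold w.
    rewrite root_unity_orthogonal by assumption.
    destruct (Nat.eq_dec i j); [now subst|ring].
Qed.

(** * Coefficients of bounded polynomials *)

Lemma rsum_le (f g : nat -> R) (N : nat) :
  (forall k, (k < N)%nat -> f k <= g k) -> rsum f N <= rsum g N.
Proof.
  induction N as [|N IH]; intros H; simpl; [lra|].
  apply Rplus_le_compat; [apply IH; intros; apply H|apply H]; lia.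
Qed.

Lemma rsum_scal (x : R) (f : nat -> R) (N : nat) :
  rsum (fun k => x * f k) N = x * rsum f N.
Proof. induction N as [|N IH]; simpl; [|rewrite IH]; ring. Qed.

Lemma rsum_prefix_le (f : nat -> R) (M N : nat) :
  (forall k, 0 <= f k) -> rsum f M <= rsum f (M + N).
Proof.
  intros H. induction N as [|N IH].
  - rewrite Nat.add_0_r. lra.
  - rewrite Nat.add_succ_r. simpl. specialize (H (M + N)%nat). lra.
Qed.

Lemma rsum_zero_tail (f : nat -> R) (M N : nat) :
  (forall k, (M <= k)%nat -> f k = 0) -> rsum f (M + N) = rsum f M.
Proof.
  intros H. induction N as [|N IH].
  - now rewrite Nat.add_0_r.
  - rewrite Nat.add_succ_r. simpl. rewrite IH, H by lia. ring.
Qed.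

(** Multiplication by the variable, on coefficient sequences. *)
Definition shift (a : nat -> C) (n : nat) : C :=
  match n with O => RtoC 0 | S m => a m end.

Lemma poly_sum_shift (a : nat -> C) (N : nat) (z : C) :
  poly_sum (shift a) (S N) z = (z * poly_sum a N z)%C.
Proof.
  induction N as [|N IH]; unfold poly_sum in *.
  - simpl. ring.
  - simpl csum in IH |- *. rewrite IH. simpl. ring.
Qed.

Lemma poly_sum_zero_tail (a : nat -> C) (M N : nat) (z : C) :
  (forall k, (M <= k)%nat -> a k = RtoC 0) ->
  poly_sum a (M + N) z = poly_sum a M z.
Proof.
  intros H. induction N as [|N IH].
  - now rewrite Nat.add_0_r.
  - rewrite Nat.add_succ_r. unfold poly_sum in *. simpl.
    rewrite IH, H by lia. ring.
Qed.

Lemma parseval_le (u h : nat -> C) (N : nat) (B : R) :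
  (0 < N)%nat ->
  (forall z, Cmod z = 1 ->
     Cmod (poly_sum h N z) <= B * Cmod (poly_sum u N z)) ->
  rsum (fun n => Cmod (h n) ^ 2) N <= B ^ 2 * rsum (fun n => Cmod (u n) ^ 2) N.
Proof.
  intros HN H.
  apply (Rmult_le_reg_l (INR N)); [now apply lt_0_INR|].
  rewrite <- (parseval h N).
  replace (INR N * (B ^ 2 * rsum (fun n => Cmod (u n) ^ 2) N))
    with (B ^ 2 * (INR N * rsum (fun n => Cmod (u n) ^ 2) N)) by ring.
  rewrite <- (parseval u N), <- rsum_scal.
  apply rsum_le; intros k _.
  rewrite <- Rpow_mult_distr. apply pow_incr. split; [apply Cmod_ge_0|].
  apply H. now rewrite Cmod_pow, Cmod_root_unity, pow1.
Qed.

Lemma exists_phase (x : C) :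
  exists mu : C, Cmod mu = 1 /\ x = (mu * Cmod x)%C.
Proof.
  destruct (Req_dec (Cmod x) 0) as [E|Hne].
  - exists (RtoC 1). split; [apply Cmod_1|].
    rewrite E. rewrite (Cmod_eq_0 x E). ring.
  - assert (Hc : RtoC (Cmod x) <> RtoC 0) by (intros E; apply Hne, RtoC_inj, E).
    exists (x / Cmod x)%C. split.
    + rewrite Cmod_div, Cmod_R, Rabs_pos_eq by (assumption || apply Cmod_ge_0).
      now field.
    + now field.
Qed.

(** Parseval is applied to the product of the polynomial with
    [u = B + mu (conj a_1 z^2 + conj a_0 z^3)].  The exponents 2 and 3 send [a_1]
    and [a_0] to the coefficient of [z^3], where they build up
    [B a_3 + mu (|a_0|^2 + |a_1|^2)]; the coefficients of [1] and [z] of the product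
    remain [B a_0] and [B a_1], and the common term [B^2 (|a_0|^2 + |a_1|^2)]
    cancels. *)
Lemma bounded_poly_coeffs (a : nat -> C) (N : nat) (B : R) :
  (4 <= N)%nat ->
  (forall z, Cmod z = 1 -> Cmod (poly_sum a N z) <= B) ->
  B * Cmod (a 3%nat) + Cmod (a 0%nat) ^ 2 + Cmod (a 1%nat) ^ 2 <= B ^ 2.
Proof.
  intros HN HB.
  assert (HB0 : 0 <= B).
  { eapply Rle_trans; [|apply (HB (RtoC 1)), Cmod_1]. apply Cmod_ge_0. }
  (* Truncating the sequence makes it agree with its polynomial, so that shifted
     copies can be summed up to any larger bound. *)
  set (b := fun n => if Nat.ltb n N then a n else RtoC 0).
  assert (Hb : forall k, (N <= k)%nat -> b k = RtoC 0).
  { intros k Hk. unfold b. destruct (Nat.ltb_spec k N); [lia|easy]. }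
  assert (Hba : forall k, (k < N)%nat -> b k = a k).
  { intros k Hk. unfold b. destruct (Nat.ltb_spec k N); [easy|lia]. }
  assert (HbB : forall z, Cmod z = 1 -> Cmod (poly_sum b N z) <= B).
  { intros z Hz. replace (poly_sum b N z) with (poly_sum a N z); [now apply HB|].
    apply csum_ext; intros k Hk. now rewrite Hba. }
  rewrite <- !Hba by lia. clear HB Hba.
  set (q := Cmod (b 0%nat) ^ 2 + Cmod (b 1%nat) ^ 2).
  destruct (exists_phase (b 3%nat)) as (mu & Hmu & Hphase).
  set (al := (mu * Cconj (b 1%nat))%C). set (be := (mu * Cconj (b 0%nat))%C).
  set (u := fun n => match n with
     O => RtoC B | 2%nat => al | 3%nat => be | _ => RtoC 0 end).
  set (h := fun n => (B * b n + al * shift (shift b) n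
                      + be * shift (shift (shift b)) n)%C).
  assert (Hu : forall z, poly_sum u (N + 3) z = (B + al * z ^ 2 + be * z ^ 3)%C).
  { intros z. replace (N + 3)%nat with (4 + (N - 1))%nat by lia.
    rewrite poly_sum_zero_tail.
    - unfold poly_sum, u. simpl. ring.
    - intros [|[|[|[|k]]]] Hk; try lia; reflexivity. }
  assert (Hh : forall z, poly_sum h (N + 3) z =
     (poly_sum b N z * poly_sum u (N + 3) z)%C).
  { intros z. rewrite Hu.
    transitivity (B * poly_sum b (N + 3) z + al * poly_sum (shift (shift b)) (N + 3) z
      + be * poly_sum (shift (shift (shift b))) (N + 3) z)%C.
    - unfold poly_sum. rewrite <- !csum_scal, <- !csum_plus.
      apply csum_ext; intros k _. unfold h. ring.
    - replace (N + 3)%nat with (S (S (S N))) by lia.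
      rewrite !poly_sum_shift.
      replace (S N) with (N + 1)%nat by lia.
      replace (S (S (N + 1))) with (N + 3)%nat by lia.
      rewrite !poly_sum_zero_tail by assumption. ring. }
  assert (HP := parseval_le u h (N + 3) B ltac:(lia)).
  assert (HP' : rsum (fun n => Cmod (h n) ^ 2) (N + 3)
     <= B ^ 2 * rsum (fun n => Cmod (u n) ^ 2) (N + 3)).
  { apply HP. intros z Hz. rewrite Hh, Cmod_mult.
    apply Rmult_le_compat_r; [apply Cmod_ge_0|]. now apply HbB. }
  clear HP.
  (* Only the coefficients 0, 1 and 3 of the product are kept. *)
  replace (N + 3)%nat with (4 + (N - 1))%nat in HP' by lia.
  assert (HL := rsum_prefix_le (fun n => Cmod (h n) ^ 2) 4 (N - 1)
    (fun k => pow2_ge_0 _)).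
  rewrite (rsum_zero_tail (fun n => Cmod (u n) ^ 2) 4) in HP'.
  2: { intros [|[|[|[|k]]]] Hk; try lia. simpl. rewrite Cmod_0. ring. }
  assert (H0 : Cmod (h 0%nat) = B * Cmod (b 0%nat)).
  { unfold h; simpl. rewrite !Cmult_0_r, !Cplus_0_r, Cmod_mult, Cmod_R.
    now rewrite Rabs_pos_eq. }
  assert (H1 : Cmod (h 1%nat) = B * Cmod (b 1%nat)).
  { unfold h; simpl. rewrite !Cmult_0_r, !Cplus_0_r, Cmod_mult, Cmod_R.
    now rewrite Rabs_pos_eq. }
  assert (H3 : Cmod (h 3%nat) = B * Cmod (b 3%nat) + q).
  { assert (E : h 3%nat = (mu * RtoC (B * Cmod (b 3%nat) + q))%C).
    { unfold h; simpl. rewrite Hphase at 1. unfold al, be, q.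
      rewrite !RtoC_plus, !RtoC_mult, !Cmod2_conj. ring. }
    rewrite E, Cmod_mult, Hmu, Cmod_R, Rabs_pos_eq; [ring|].
    assert (X := Cmod_ge_0 (b 3%nat)). unfold q. nra. }
  simpl rsum in HL, HP'.
  rewrite H0, H1, H3 in HL.
  assert (X2 := pow2_ge_0 (Cmod (h 2%nat))).
  assert (Eal : Cmod al = Cmod (b 1%nat))
    by (unfold al; rewrite Cmod_mult, Hmu, Cmod_conj; ring).
  assert (Ebe : Cmod be = Cmod (b 0%nat))
    by (unfold be; rewrite Cmod_mult, Hmu, Cmod_conj; ring).
  rewrite Eal, Ebe, Cmod_R, Cmod_0, Rabs_pos_eq in HP' by assumption.
  assert (X3 := Cmod_ge_0 (b 3%nat)).
  assert (Hfin : (B * Cmod (b 3%nat) + q) ^ 2 <= (B ^ 2) ^ 2) by (unfold q in *; nra).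
  replace (B * Cmod (b 3%nat) + Cmod (b 0%nat) ^ 2 + Cmod (b 1%nat) ^ 2)
    with (B * Cmod (b 3%nat) + q) by (unfold q; ring).
  apply Rsqr_incr_0_var; [|apply pow2_ge_0]. unfold Rsqr. simpl in *. lra.
Qed.

(** * Complex series and their majorants *)

Local Notation is_Cseries := (@is_series C_AbsRing C_NormedModule).
Local Notation is_Cpseries := (@is_pseries C_AbsRing C_NormedModule).
Local Notation is_Cderive := (@is_derive C_AbsRing C_NormedModule).

Lemma sum_n_csum (f : nat -> C) (n : nat) :
  @sum_n C_AbelianMonoid f n = csum f (S n).
Proof.
  induction n as [|n IH].
  - rewrite sum_O. simpl. ring.
  - rewrite sum_Sn, IH. reflexivity.
Qed.

Lemma is_Cpseries_pow (c : nat -> C) (z l : C) :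
  is_Cpseries c z l <-> is_Cseries (fun n => (c n * z ^ n)%C) l.
Proof.
  assert (E : forall n, @scal C_AbsRing C_NormedModule (@pow_n C_AbsRing z n) (c n)
                        = (c n * z ^ n)%C).
  { intros n. change (Cmult (@pow_n C_AbsRing z n) (c n) = (c n * z ^ n)%C).
    replace (@pow_n C_AbsRing z n) with (z ^ n)%C; [ring|].
    induction n as [|n IH]; [reflexivity|].
    rewrite Cpow_S, IH. reflexivity. }
  split; apply is_series_ext; intros n; [apply E | symmetry; apply E].
Qed.

Lemma Cmod_Cseries_le (f : nat -> C) (d : nat -> R) (l : C) :
  (forall n, Cmod (f n) <= d n) -> is_Cseries f l -> ex_series d ->
  Cmod l <= Series d.
Proof.
  intros Hd Hf Hex.
  apply (is_lim_seq_le (fun n => Cmod (@sum_n C_AbelianMonoid f n)) (sum_n d)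
    (Cmod l) (Series d)).
  - intros n. induction n as [|n IH].
    + rewrite !sum_O. apply Hd.
    + rewrite !sum_Sn. eapply Rle_trans; [apply Cmod_triangle|].
      apply Rplus_le_compat; [exact IH|apply Hd].
  - eapply filterlim_comp; [exact Hf|].
    apply (@filterlim_norm C_AbsRing C_NormedModule l).
  - apply Series_correct, Hex.
Qed.

Lemma is_Cseries_tail (f : nat -> C) (l : C) (N : nat) :
  is_Cseries f l -> is_Cseries (fun k => f (N + k)%nat) (l - csum f N)%C.
Proof.
  intros Hf. destruct N as [|N].
  - replace (l - csum f 0)%C with l by (simpl; ring). exact Hf.
  - apply (@is_series_incr_n C_AbsRing C_NormedModule f (S N)); [lia|].
    refine (eq_ind l (fun t => is_Cseries f t) Hf _ _).
    change (l = ((l - csum f (S N)) + @sum_n C_AbelianMonoid f N)%C).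
    rewrite sum_n_csum. ring.
Qed.

Lemma is_Cseries_unique (f : nat -> C) (l1 l2 : C) :
  is_Cseries f l1 -> is_Cseries f l2 -> l1 = l2.
Proof.
  exact (@filterlim_locally_unique nat C_AbsRing C_NormedModule eventually _ _ l1 l2).
Qed.

(** The bound depends only on the majorant [d]: this is the uniform convergence
    used on circles. *)
Lemma Cmod_Cseries_tail_le (f : nat -> C) (d : nat -> R) (l : C) (N : nat) :
  (forall n, Cmod (f n) <= d n) -> is_Cseries f l -> ex_series d ->
  Cmod (l - csum f N) <= Series (fun k => d (N + k)%nat).
Proof.
  intros Hd Hf Hex. apply (Cmod_Cseries_le (fun k => f (N + k)%nat)).
  - intros k. apply Hd.
  - now apply is_Cseries_tail.
  - now apply ex_series_incr_n.
Qed.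

Lemma Series_tail_lim (d : nat -> R) :
  ex_series d -> is_lim_seq (fun N => Series (fun k => d (N + k)%nat)) 0.
Proof.
  intros Hex. apply is_lim_seq_incr_1.
  apply (is_lim_seq_ext (fun n => Series d - sum_n d n)).
  - intros n. rewrite (Series_incr_n d (S n)) by (lia || assumption).
    simpl Init.Nat.pred. rewrite sum_n_Reals. simpl. ring.
  - replace (Finite 0) with (Finite (Series d - Series d)) by (f_equal; ring).
    apply is_lim_seq_minus'; [apply is_lim_seq_const|].
    apply (Series_correct d Hex).
Qed.

(** * Complex power series in the unit disc *)

Definition converges_in_disc (c : nat -> C) : Prop :=
  forall z, unit_disc z -> exists l, is_Cpseries c z l.

(** Reduces absolute convergence to the theory of real power series.  The terms of
    the series are bounded at the midpoint [s] of [r] and 1, as differences of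
    bounded partial sums, so the real series of moduli has radius at least [s]. *)
Lemma CV_radius_Cmod (c : nat -> C) (r : R) :
  converges_in_disc c -> 0 <= r < 1 ->
  Rbar_lt (Rabs r) (CV_radius (fun n => Cmod (c n))).
Proof.
  intros Hc Hr. set (s := (1 + r) / 2).
  apply Rbar_lt_le_trans with s.
  { simpl. unfold s. rewrite Rabs_pos_eq; lra. }
  apply (CV_radius_bounded (fun n => Cmod (c n))).
  destruct (Hc (RtoC s)) as [l Hl].
  { unfold unit_disc, s. rewrite Cmod_R, Rabs_pos_eq; lra. }
  apply is_Cpseries_pow in Hl.
  destruct (filterlim_bounded _ (ex_intro _ l Hl)) as [M HM].
  exists (M + M). intros n.
  replace (Rabs (Cmod (c n) * s ^ n)) with (Cmod (c n * s ^ n)%C).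
  - assert (HM' : forall n, Cmod (csum (fun n => (c n * s ^ n)%C) (S n)) <= M).
    { intros k. rewrite <- sum_n_csum. apply HM. }
    destruct n as [|n].
    + specialize (HM' 0%nat). change (Cmod (0 + c 0%nat * s ^ 0)%C <= M) in HM'.
      rewrite Cplus_0_l in HM'.
      assert (X := Cmod_ge_0 (c 0%nat * s ^ 0)%C). lra.
    + assert (H1 := HM' (S n)). assert (H2 := HM' n).
      set (t := csum _ (S n)) in H2.
      change (Cmod (t + c (S n) * s ^ S n)%C <= M) in H1.
      replace (c (S n) * s ^ S n)%C
        with ((t + c (S n) * s ^ S n) + - t)%C by ring.
      eapply Rle_trans; [apply Cmod_triangle|]. rewrite Cmod_opp. lra.
  - assert (Hs : 0 <= s) by (unfold s; lra).
    rewrite Cmod_mult, Cmod_pow, Cmod_R, (Rabs_pos_eq s Hs), Rabs_pos_eq; [easy|].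
    apply Rmult_le_pos; [apply Cmod_ge_0|now apply pow_le].
Qed.

Lemma ex_series_Cmod (c : nat -> C) (r : R) :
  converges_in_disc c -> 0 <= r < 1 -> ex_series (fun n => Cmod (c n) * r ^ n).
Proof.
  intros Hc Hr.
  apply (ex_series_ext (fun n => Rabs (Cmod (c n) * r ^ n))).
  - intros n. apply Rabs_pos_eq, Rmult_le_pos; [apply Cmod_ge_0|now apply pow_le].
  - now apply CV_disk_inside, CV_radius_Cmod.
Qed.

Lemma bounded_coeffs_converge (c : nat -> C) :
  (forall n, Cmod (c n) <= 1) -> converges_in_disc c.
Proof.
  intros Hc z Hz.
  assert (Xz := Cmod_ge_0 z).
  assert (Hle : forall n, Cmod (c n * z ^ n)%C <= Cmod z ^ n).
  { intros n. rewrite Cmod_mult, Cmod_pow.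
    rewrite <- (Rmult_1_l (Cmod z ^ n)) at 2.
    apply Rmult_le_compat_r; [now apply pow_le|apply Hc]. }
  destruct (@ex_series_le C_AbsRing C_CompleteNormedModule
    (fun n => (c n * z ^ n)%C) _ Hle) as [l Hl].
  - apply ex_series_geom. now rewrite Rabs_pos_eq.
  - exists l. apply is_Cpseries_pow, Hl.
Qed.

Definition derived (c : nat -> C) (n : nat) : C := (INR (S n) * c (S n))%C.

Lemma derived_converges (c : nat -> C) :
  converges_in_disc c -> converges_in_disc (derived c).
Proof.
  intros Hc z Hz.
  assert (X := Cmod_ge_0 z).
  assert (Hex : ex_series (fun n =>
     PS_derive (fun n => Cmod (c n)) n * Cmod z ^ n)).
  { apply (ex_series_ext (fun n =>
       Rabs (PS_derive (fun n => Cmod (c n)) n * Cmod z ^ n))).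
    - intros n. apply Rabs_pos_eq, Rmult_le_pos; [|now apply pow_le].
      apply Rmult_le_pos; [apply pos_INR|apply Cmod_ge_0].
    - apply CV_disk_inside. rewrite CV_radius_derive. now apply CV_radius_Cmod. }
  assert (Hle : forall n, Cmod (derived c n * z ^ n)%C
                  <= PS_derive (fun n => Cmod (c n)) n * Cmod z ^ n).
  { intros n. right. unfold derived, PS_derive.
    rewrite !Cmod_mult, Cmod_pow, Cmod_R, (Rabs_pos_eq _ (pos_INR _)).
    reflexivity. }
  destruct (@ex_series_le C_AbsRing C_CompleteNormedModule
    (fun n => (derived c n * z ^ n)%C) _ Hle Hex) as [l Hl].
  exists l. apply is_Cpseries_pow, Hl.
Qed.

(** Induction on the exponent: the remainder [E_k] of [w^k] satisfies
    [E_(k+1) = w E_k + k z^(k-1) (w - z)^2].  The constant is twice the optimal one,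
    and is the coefficient produced by differentiating [r^(n+2)] twice. *)
Lemma Cpow_taylor2 (z w : C) (r : R) (n : nat) :
  Cmod z <= r -> Cmod w <= r ->
  Cmod (w ^ (S (S n)) - z ^ (S (S n)) - (w - z) * (INR (S (S n)) * z ^ (S n)))%C
  <= INR (S (S n)) * INR (S n) * r ^ n * Cmod (w - z) ^ 2.
Proof.
  intros Hz Hw.
  assert (Xz := Cmod_ge_0 z). assert (Xw := Cmod_ge_0 w).
  induction n as [|n IH].
  - replace (w ^ 2 - z ^ 2 - (w - z) * (INR 2 * z ^ 1))%C with ((w - z) ^ 2)%C
      by (rewrite (RtoC_plus 1 1 : RtoC (INR 2) = _); simpl; ring).
    rewrite Cmod_pow. assert (X := pow2_ge_0 (Cmod (w - z))). simpl in *. lra.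
  - set (k := S (S n)) in *.
    replace (w ^ S k - z ^ S k - (w - z) * (INR (S k) * z ^ k))%C
      with (w * (w ^ k - z ^ k - (w - z) * (INR k * z ^ S n))
            + INR k * z ^ S n * (w - z) ^ 2)%C
      by (rewrite S_INR, RtoC_plus; unfold k; simpl; ring).
    eapply Rle_trans; [apply Cmod_triangle|].
    rewrite !Cmod_mult, !Cmod_pow, Cmod_R, (Rabs_pos_eq _ (pos_INR _)).
    assert (Xd := pow2_ge_0 (Cmod (w - z))).
    assert (Hp : Cmod z ^ S n <= r ^ S n) by (apply pow_incr; lra).
    assert (Hr := pow_le r (S n) ltac:(lra)).
    assert (Hk := pos_INR k). assert (Hn := pos_INR (S n)).
    apply Rle_trans with
      (r * (INR k * INR (S n) * r ^ n * Cmod (w - z) ^ 2)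
       + INR k * r ^ S n * Cmod (w - z) ^ 2).
    + apply Rplus_le_compat.
      * apply Rmult_le_compat; try assumption; apply Cmod_ge_0.
      * apply Rmult_le_compat_r; [assumption|].
        now apply Rmult_le_compat_l.
    + rewrite (S_INR k).
      replace (INR (S n)) with (INR k - 1) in * by (unfold k; rewrite (S_INR (S n)); ring).
      simpl pow in *. 
      assert (0 <= INR k * (r * r ^ n) * Cmod (w - z) ^ 2)
        by (apply Rmult_le_pos; [apply Rmult_le_pos|]; assumption).
      simpl pow in *. lra.
Qed.

Lemma is_Cderive_of_quadratic (F : C -> C) (z g : C) (r K : R) :
  Cmod z < r ->
  (forall w, Cmod w <= r ->
     Cmod (F w - F z - (w - z) * g)%C <= K * Cmod (w - z) ^ 2) ->
  is_Cderive F z g.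
Proof.
  intros Hr HK. split; [apply is_linear_scal_l|].
  intros x Hx.
  apply (is_filter_lim_locally_unique (V := AbsRing_NormedModule C_AbsRing)) in Hx.
  subst x. intros eps.
  set (K' := Rmax K 1).
  assert (HK1 : 1 <= K') by apply Rmax_r.
  assert (HK2 : K <= K') by apply Rmax_l.
  assert (Hpos : 0 < Rmin (r - Cmod z) (eps / K')).
  { apply Rmin_glb_lt; [lra|]. apply Rdiv_lt_0_compat; [apply cond_pos|lra]. }
  exists (mkposreal _ Hpos). intros w Hw.
  change (Cmod (w - z)%C < Rmin (r - Cmod z) (eps / K')) in Hw.
  change (Cmod (F w - F z - (w - z) * g)%C <= eps * Cmod (w - z)%C).
  assert (H1 : Cmod (w - z) < r - Cmod z)
    by (eapply Rlt_le_trans; [exact Hw|apply Rmin_l]).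
  assert (H2 : Cmod (w - z) < eps / K')
    by (eapply Rlt_le_trans; [exact Hw|apply Rmin_r]).
  assert (H3 : K' * Cmod (w - z) <= eps).
  { replace (pos eps) with (K' * (eps / K')) by (field; lra).
    apply Rmult_le_compat_l; lra. }
  assert (Hwr : Cmod w <= r).
  { replace w with ((w - z) + z)%C by ring.
    eapply Rle_trans; [apply Cmod_triangle|]. lra. }
  eapply Rle_trans; [apply HK, Hwr|].
  assert (X := Cmod_ge_0 (w - z)). simpl pow. nra.
Qed.

(** Termwise differentiation: summing the quadratic remainders of the monomials
    bounds [F w - F z - (w - z) g] by a constant times [|w - z|^2].  The constant is
    the second derivative of the real series of moduli, which converges because
    differentiation preserves the radius of convergence. *)
Lemma is_Cderive_pseries (c : nat -> C) (F : C -> C) (z g : C) :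
  (forall w, unit_disc w -> is_Cpseries c w (F w)) ->
  unit_disc z -> is_Cpseries (derived c) z g -> is_Cderive F z g.
Proof.
  intros HF Hz Hg. unfold unit_disc in Hz.
  assert (Hc : converges_in_disc c) by (intros w Hw; eexists; now apply HF).
  assert (Xz := Cmod_ge_0 z).
  (* A disc around 0 containing a neighbourhood of [z], inside the unit disc. *)
  set (r := (1 + Cmod z) / 2).
  assert (Hr : 0 <= r < 1) by (unfold r; lra).
  set (d := fun n => match n with
    | S (S m) => INR (S (S m)) * INR (S m) * Cmod (c (S (S m))) * r ^ m
    | _ => 0 end).
  assert (Hd : ex_series d).
  { apply (ex_series_incr_n d 2).
    apply (ex_series_ext (fun n =>
      Rabs (PS_derive (PS_derive (fun n => Cmod (c n))) n * r ^ n))).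
    - intros n. unfold PS_derive. simpl (2 + n)%nat. unfold d.
      assert (X := Cmod_ge_0 (c (S (S n)))). assert (Y := pow_le r n (proj1 Hr)).
      assert (U := pos_INR (S n)). assert (V := pos_INR (S (S n))).
      rewrite Rabs_pos_eq.
      { match goal with |- @eq _ ?x ?y => change (@eq R x y) end. ring. }
      repeat apply Rmult_le_pos; assumption.
    - apply CV_disk_inside. rewrite !CV_radius_derive. now apply CV_radius_Cmod. }
  apply (is_Cderive_of_quadratic F z g r (Series d)); [unfold r; lra|].
  intros w Hw. rewrite <- Series_scal_r.
  (* The derived series with its index raised by one, aligned with that of [F]. *)
  set (dz := fun n => match n with
    | O => RtoC 0 | S m => (derived c m * z ^ m)%C end).
  apply (Cmod_Cseries_le (fun n => (c n * w ^ n - c n * z ^ n - (w - z) * dz n)%C)).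
  - intros [|[|n]].
    + replace (c 0%nat * w ^ 0 - c 0%nat * z ^ 0 - (w - z) * dz 0%nat)%C with (RtoC 0)
        by (unfold dz; simpl; ring).
      unfold d.
      rewrite Cmod_0. lra.
    + replace (c 1%nat * w ^ 1 - c 1%nat * z ^ 1 - (w - z) * dz 1%nat)%C with (RtoC 0)
        by (unfold dz, derived; simpl; ring).
      unfold d.
      rewrite Cmod_0. lra.
    + unfold dz, derived.
      replace (c (S (S n)) * w ^ S (S n) - c (S (S n)) * z ^ S (S n) -
        (w - z) * (INR (S (S n)) * c (S (S n)) * z ^ S n))%C
      with (c (S (S n)) * (w ^ S (S n) - z ^ S (S n)
             - (w - z) * (INR (S (S n)) * z ^ S n)))%C by ring.
      rewrite Cmod_mult. unfold d.
      replace (INR (S (S n)) * INR (S n) * Cmod (c (S (S n))) * r ^ n * Cmod (w - z) ^ 2)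
      with (Cmod (c (S (S n))) * (INR (S (S n)) * INR (S n) * r ^ n * Cmod (w - z) ^ 2))
        by ring.
      apply Rmult_le_compat_l; [apply Cmod_ge_0|].
      apply Cpow_taylor2; [unfold r; lra|assumption].
  - apply (@is_series_minus C_AbsRing C_NormedModule).
    + apply (@is_series_minus C_AbsRing C_NormedModule);
        apply is_Cpseries_pow, HF; unfold unit_disc; lra.
    + apply (@is_series_scal C_AbsRing C_NormedModule).
      apply (@is_series_decr_1 C_AbsRing C_NormedModule).
      apply is_Cpseries_pow in Hg.
      refine (eq_ind g (fun t => is_Cseries _ t) Hg _ _).
      change (g = (g + - RtoC 0)%C). ring.
  - apply (ex_series_scal_r _ _ Hd).
Qed.

(** * Coefficients of bounded analytic functions *)

(** On the circle of radius [r] the partial sums converge uniformly to [f], so some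
    partial sum of the dilated series [b_n r^n] is bounded by [1 + eps] on the unit
    circle and [bounded_poly_coeffs] applies to it. *)
Lemma bounded_dilation_coeffs (b : nat -> C) (f : C -> C) (r eps : R) :
  (forall z, unit_disc z -> is_Cpseries b z (f z)) ->
  (forall z, unit_disc z -> Cmod (f z) <= 1) ->
  0 <= r < 1 -> 0 < eps ->
  (1 + eps) * (Cmod (b 3%nat) * r ^ 3) + Cmod (b 0%nat) ^ 2
    + (Cmod (b 1%nat) * r) ^ 2 <= (1 + eps) ^ 2.
Proof.
  intros Hb Hf Hr Heps.
  assert (Hc : converges_in_disc b) by (intros z Hz; exists (f z); now apply Hb).
  set (d := fun n => Cmod (b n) * r ^ n).
  assert (Hd : ex_series d) by now apply ex_series_Cmod.
  destruct (proj2 (is_lim_seq_spec _ 0) (Series_tail_lim d Hd)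
     (mkposreal eps Heps)) as [N HN].
  simpl in HN. set (M := (N + 4)%nat).
  specialize (HN M ltac:(unfold M; lia)). rewrite Rminus_0_r in HN.
  apply Rabs_def2 in HN.
  set (a := fun n => (b n * r ^ n)%C).
  assert (Hterm : forall n, Cmod (a n) = d n).
  { intros n. unfold a. now rewrite Cmod_mult, Cmod_pow, Cmod_R, (Rabs_pos_eq r) by lra. }
  assert (HP : (1 + eps) * Cmod (a 3%nat) + Cmod (a 0%nat) ^ 2 + Cmod (a 1%nat) ^ 2
               <= (1 + eps) ^ 2).
  { apply (bounded_poly_coeffs a M); [unfold M; lia|]. intros z Hz.
    assert (Hrz : unit_disc (r * z)%C).
    { unfold unit_disc. rewrite Cmod_mult, Hz, Cmod_R, Rabs_pos_eq; lra. }
    assert (HT := Cmod_Cseries_tail_le (fun n => (a n * z ^ n)%C) d (f (r * z)%C) M).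
    assert (HT' : Cmod (f (r * z)%C - poly_sum a M z)%C <= eps).
    { eapply Rle_trans; [apply HT|lra]; [| |exact Hd].
      - intros n. right. now rewrite Cmod_mult, Cmod_pow, Hz, pow1, Hterm, Rmult_1_r.
      - eapply is_series_ext; [|exact (proj1 (is_Cpseries_pow _ _ _) (Hb _ Hrz))].
        intros n. unfold a. change (b n * (r * z) ^ n = b n * r ^ n * z ^ n)%C.
        rewrite Cpow_mult_l. ring. }
    replace (poly_sum a M z)
      with (f (r * z) + - (f (r * z) - poly_sum a M z))%C by ring.
    eapply Rle_trans; [apply Cmod_triangle|]. rewrite Cmod_opp.
    specialize (Hf _ Hrz). lra. }
  rewrite !Hterm in HP. unfold d in HP.
  rewrite pow_O, pow_1, Rmult_1_r in HP. exact HP.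
Qed.

(** The limit [r -> 1], [eps -> 0] along [r = 1 - t], [eps = t]: if the left-hand
    side [q] exceeded 1, then [q (1 - 3 t) <= (1 + t)^2 <= 1 + 3 t] would fail for
    small [t]. *)
Lemma bounded_function_coeffs (b : nat -> C) (f : C -> C) :
  (forall z, unit_disc z -> is_Cpseries b z (f z)) ->
  (forall z, unit_disc z -> Cmod (f z) <= 1) ->
  Cmod (b 3%nat) + Cmod (b 0%nat) ^ 2 + Cmod (b 1%nat) ^ 2 <= 1.
Proof.
  intros Hb Hf.
  assert (X3 := Cmod_ge_0 (b 3%nat)). assert (X0 := pow2_ge_0 (Cmod (b 0%nat))).
  assert (X1 := pow2_ge_0 (Cmod (b 1%nat))).
  set (q := Cmod (b 3%nat) + Cmod (b 0%nat) ^ 2 + Cmod (b 1%nat) ^ 2).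
  destruct (Rle_lt_dec q 1) as [|Hlt]; [assumption|exfalso].
  (* Half the value of [t] for which [q (1 - 3 t) = 1 + 3 t]. *)
  set (t := (q - 1) / (6 * (1 + q))).
  assert (Ht : t * (6 * (1 + q)) = q - 1) by (unfold t; field; lra).
  assert (Ht0 : 0 < t) by (unfold t; apply Rdiv_lt_0_compat; lra).
  clearbody t. assert (Ht1 : t < 1) by nra.
  assert (H := bounded_dilation_coeffs b f (1 - t) t Hb Hf ltac:(lra) Ht0).
  assert (Hq1 : 1 - 3 * t <= (1 - t) ^ 3).
  { assert (Z : 0 <= t ^ 2 * (3 - t)) by (apply Rmult_le_pos; [apply pow2_ge_0|lra]). lra. }
  assert (Hq2 : 1 - 3 * t <= (1 - t) ^ 2) by nra.
  assert (Hp : 0 <= (1 - t) ^ 3) by (apply pow_le; lra).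
  assert (HS : q * (1 - 3 * t) <= (1 + t) ^ 2).
  { eapply Rle_trans; [|exact H]. unfold q. rewrite Rpow_mult_distr.
    assert (Y1 := Rmult_le_compat_l _ _ _ X3 Hq1).
    assert (Y2 := Rmult_le_compat_l _ _ _ X1 Hq2).
    assert (Y3 := Rmult_le_pos _ _ (Rlt_le _ _ Ht0) (Rmult_le_pos _ _ X3 Hp)).
    assert (Y4 := Rmult_le_pos _ _ (Rlt_le _ _ Ht0) X0). lra. }
  assert (Htt : t ^ 2 <= t) by nra. lra.
Qed.

(** * Integration along a segment *)

(** The chain rule from the complex field to the real line.  The two derivatives
    live over different base rings, so it is proved on the first-order remainders,
    with precision [eps / (1 + |z|)] to allow for [z = 0]. *)
Lemma is_derive_segment (F : C -> C) (z g : C) (t : R) :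
  is_Cderive F (t * z)%C g ->
  @is_derive R_AbsRing C_R_NormedModule (fun s => F (s * z)%C) t (g * z)%C.
Proof.
  intros [_ HF]. split; [apply is_linear_scal_l|].
  intros x Hx. apply (is_filter_lim_locally_unique (V := R_NormedModule)) in Hx.
  subst x. intros eps.
  specialize (HF (t * z)%C (fun P H => H)).
  assert (Xz := Cmod_ge_0 z).
  assert (He : 0 < eps / (1 + Cmod z)) by (apply Rdiv_lt_0_compat; [apply cond_pos|lra]).
  destruct (HF (mkposreal _ He)) as [dl Hdl].
  assert (Hd : 0 < dl / (1 + Cmod z)) by (apply Rdiv_lt_0_compat; [apply cond_pos|lra]).
  exists (mkposreal _ Hd). intros s Hs.
  change (Rabs (s - t) < dl / (1 + Cmod z)) in Hs.
  assert (E : (s * z - t * z = RtoC (s - t) * z)%C) by (rewrite RtoC_minus; ring).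
  assert (Hb : Cmod (s * z - t * z)%C < dl).
  { rewrite E, Cmod_mult, Cmod_R. assert (X := Rabs_pos (s - t)).
    assert (Hm : Rabs (s - t) * (1 + Cmod z) < dl).
    { replace (pos dl) with (dl / (1 + Cmod z) * (1 + Cmod z)) by (field; lra).
      apply Rmult_lt_compat_r; lra. }
    nra. }
  specialize (Hdl (s * z)%C Hb).
  change (Cmod (F (s * z) - F (t * z) - (s * z - t * z) * g)%C
          <= eps / (1 + Cmod z) * Cmod (s * z - t * z)%C) in Hdl.
  assert (G : Cmod (F (s * z) - F (t * z) - RtoC (s - t) * (g * z))%C
     <= eps * Rabs (s - t)).
  { replace (RtoC (s - t) * (g * z))%C with ((s * z - t * z) * g)%C by (rewrite E; ring).
    eapply Rle_trans; [exact Hdl|]. rewrite E, Cmod_mult, Cmod_R.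
    assert (Y : Cmod z / (1 + Cmod z) <= 1).
    { apply (Rmult_le_reg_r (1 + Cmod z)); [lra|]. unfold Rdiv.
      rewrite Rmult_assoc, Rinv_l; lra. }
    replace (eps / (1 + Cmod z) * (Rabs (s - t) * Cmod z))
      with ((eps * Rabs (s - t)) * (Cmod z / (1 + Cmod z))) by (field; lra).
    rewrite <- (Rmult_1_r (eps * Rabs (s - t))) at 2.
    apply Rmult_le_compat_l; [|exact Y].
    apply Rmult_le_pos; [left; apply cond_pos|apply Rabs_pos]. }
  rewrite scal_R_Cmult.
  rewrite Cmod_norm in G. exact G.
Qed.

(** Complex differentiability of [g] serves to make the integrand continuous along
    the segment. *)
Lemma segment_integral_primitive (F g : C -> C) (z : C) :
  (forall w, unit_disc w -> is_Cderive F w (g w)) ->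
  (forall w, unit_disc w -> exists l, is_Cderive g w l) ->
  unit_disc z -> segment_integral g z = (F z - F 0)%C.
Proof.
  intros HF Hg Hz. unfold unit_disc in Hz.
  assert (Hseg : forall t, Rmin 0 1 <= t <= Rmax 0 1 -> unit_disc (t * z)%C).
  { intros t. rewrite Rmin_left, Rmax_right by lra. intros Ht.
    unfold unit_disc. rewrite Cmod_mult, Cmod_R, Rabs_pos_eq by lra.
    assert (X := Cmod_ge_0 z). nra. }
  unfold segment_integral. apply (@is_RInt_unique C_R_CompleteNormedModule).
  assert (H := @is_RInt_derive C_R_CompleteNormedModule
     (fun s : R => F (s * z)%C) (fun s : R => (g (s * z) * z)%C) 0 1).
  assert (E : (F z - F 0)%C = @minus C_R_NormedModule (F (1 * z)%C) (F (0 * z)%C)).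
  { rewrite Cmult_1_l, Cmult_0_l. reflexivity. }
  rewrite E. apply H; intros t Ht; specialize (Hseg t Ht).
  - apply is_derive_segment, HF, Hseg.
  - destruct (Hg _ Hseg) as [l Hl].
    apply (@ex_derive_continuous R_AbsRing C_R_NormedModule).
    exists (l * z * z)%C.
    apply (is_derive_segment (fun w => (g w * z)%C)).
    apply (@is_derive_scal_l C_AbsRing C_NormedModule).
    destruct Hl as [_ Hl]. split; [apply is_linear_scal_l|exact Hl].
Qed.

(** * The extremal function *)

Definition blaschke3 (a : R) (z : C) : C := ((a + z ^ 3) / (1 + a * z ^ 3))%C.

(** Coefficients of [a + (1 - a^2) z^3 - a (1 - a^2) z^6 + ...], given by the
    recurrence [e_(n+3) = - a e_n] for [n >= 1] that the denominator [1 + a z^3]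
    imposes. *)
Fixpoint blaschke3_coeff (a : R) (n : nat) : R :=
  match n with
  | O => a
  | S (S (S O)) => 1 - a ^ 2
  | S (S (S (S _ as m))) => - a * blaschke3_coeff a m
  | _ => 0
  end.

Definition extremal_coeff (a : R) (n : nat) : R :=
  match n with O => 0 | S m => blaschke3_coeff a m / INR (S m) end.

Lemma blaschke3_coeff_bound (a : R) (Ha : 0 <= a <= 1) (n : nat) :
  Rabs (blaschke3_coeff a n) <= 1.
Proof.
  (* The recurrence has order 3 and starts at index 1: four consecutive bounds. *)
  enough (H : forall k, Rabs (blaschke3_coeff a k) <= 1 /\
     Rabs (blaschke3_coeff a (1 + k)) <= 1 /\
     Rabs (blaschke3_coeff a (2 + k)) <= 1 /\
     Rabs (blaschke3_coeff a (3 + k)) <= 1) by apply H.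
  induction k as [|k (H0 & H1 & H2 & H3)].
  - simpl. rewrite Rabs_R0, !Rabs_pos_eq by nra. repeat split; nra.
  - repeat split; try assumption.
    change (Rabs (- a * blaschke3_coeff a (1 + k)) <= 1).
    rewrite Rabs_mult, Rabs_Ropp, Rabs_pos_eq by lra.
    assert (X := Rabs_pos (blaschke3_coeff a (1 + k))). nra.
Qed.

Lemma extremal_coeff_bound (a : R) (Ha : 0 <= a <= 1) (n : nat) :
  Rabs (extremal_coeff a n) <= 1.
Proof.
  destruct n as [|n]; unfold extremal_coeff; [rewrite Rabs_R0; lra|].
  assert (H := blaschke3_coeff_bound a Ha n). assert (X := Rabs_pos (blaschke3_coeff a n)).
  assert (Hn : 1 <= INR (S n)) by (rewrite S_INR; assert (Y := pos_INR n); lra).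
  unfold Rdiv. rewrite Rabs_mult, (Rabs_pos_eq (/ INR (S n))).
  - assert (Hi : / INR (S n) <= 1) by (rewrite <- Rinv_1; apply Rinv_le_contravar; lra).
    assert (0 < / INR (S n)) by (apply Rinv_0_lt_compat; lra). nra.
  - left. apply Rinv_0_lt_compat. lra.
Qed.

Lemma blaschke3_den_neq0 (a : R) (Ha : 0 <= a <= 1) (z : C) :
  unit_disc z -> (1 + a * z ^ 3)%C <> RtoC 0.
Proof.
  intros Hz E. unfold unit_disc in Hz. assert (X := Cmod_ge_0 z).
  assert (H : Cmod (a * z ^ 3)%C = 1).
  { replace (a * z ^ 3)%C with ((1 + a * z ^ 3) + - (1))%C by ring.
    rewrite E, Cplus_0_l. apply Cmod_m1. }
  rewrite Cmod_mult, Cmod_pow, Cmod_R, Rabs_pos_eq in H by lra.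
  assert (Cmod z ^ 3 < 1) by (apply pow_lt_1_compat; [lra|lia]).
  assert (0 <= Cmod z ^ 3) by now apply pow_le. nra.
Qed.

(** [|1 + a w|^2 - |a + w|^2 = (1 - a^2) (1 - |w|^2)] with [w = z^3]. *)
Lemma blaschke3_bound (a : R) (Ha : 0 <= a <= 1) (z : C) :
  unit_disc z -> Cmod (blaschke3 a z) <= 1.
Proof.
  intros Hz. assert (Hne := blaschke3_den_neq0 a Ha z Hz).
  unfold blaschke3. rewrite Cmod_div by assumption.
  assert (Hpos := proj1 (Cmod_gt_0 _) Hne).
  apply (Rmult_le_reg_r (Cmod (1 + a * z ^ 3)%C)); [assumption|].
  unfold Rdiv. rewrite Rmult_assoc, Rinv_l, Rmult_1_r, Rmult_1_l by lra.
  apply Rsqr_incr_0_var; [|lra].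
  rewrite !Rsqr_pow2, !Cmod2_alt.
  assert (Hw : Cmod (z ^ 3)%C ^ 2 <= 1).
  { rewrite Cmod_pow. unfold unit_disc in Hz. assert (X := Cmod_ge_0 z).
    assert (Y : Cmod z ^ 3 <= 1) by (rewrite <- (pow1 3); apply pow_incr; lra).
    assert (Y' := pow_le (Cmod z) 3 X). nra. }
  rewrite Cmod2_alt in Hw. destruct (z ^ 3)%C as [x y]. simpl in *.
  assert (P : 0 <= (1 - a * a) * (1 - (x * x + y * y))) by (apply Rmult_le_pos; nra).
  lra.
Qed.

(** The coefficients are bounded, so the series has a sum [l]; by the recurrence its
    tail from 4 is [- a z^3] times its tail from 1.  This is a linear equation for
    [l], namely [(1 + a z^3) l = a + z^3]. *)
Lemma blaschke3_expansion (a : R) (Ha : 0 <= a <= 1) (z : C) :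
  unit_disc z ->
  is_Cpseries (fun n => RtoC (blaschke3_coeff a n)) z (blaschke3 a z).
Proof.
  intros Hz.
  assert (Hb : forall n, Cmod (RtoC (blaschke3_coeff a n)) <= 1)
    by (intros n; rewrite Cmod_R; apply (blaschke3_coeff_bound a Ha)).
  destruct (bounded_coeffs_converge _ Hb z Hz) as [l Hl].
  replace (blaschke3 a z) with l; [exact Hl|].
  assert (Hs := proj1 (is_Cpseries_pow _ _ _) Hl).
  assert (H1 := is_Cseries_tail _ _ 1 Hs).
  assert (H4 := is_Cseries_tail _ _ 4 Hs).
  apply (@is_series_scal C_AbsRing C_NormedModule (- a * z ^ 3)%C) in H1.
  assert (Hrec : forall n,
    (- a * z ^ 3 * (blaschke3_coeff a (1 + n) * z ^ (1 + n)))%C =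
    (blaschke3_coeff a (4 + n) * z ^ (4 + n))%C).
  { intros n.
    change (blaschke3_coeff a (4 + n)) with (- a * blaschke3_coeff a (1 + n)).
    change (4 + n)%nat with (3 + (1 + n))%nat.
    rewrite (Cpow_add_r z 3), RtoC_mult, RtoC_opp. ring. }
  assert (E := is_Cseries_unique _ _ _ H4
    (@is_series_ext C_AbsRing C_NormedModule _ _ _ Hrec H1)).
  change (l - csum (fun n => blaschke3_coeff a n * z ^ n) 4 =
    (- a * z ^ 3) * (l - csum (fun n => blaschke3_coeff a n * z ^ n) 1))%C in E.
  assert (Hne := blaschke3_den_neq0 a Ha z Hz).
  unfold blaschke3.
  replace l with ((1 + a * z ^ 3) * l / (1 + a * z ^ 3))%C by now field.
  f_equal.
  transitivity ((l - csum (fun n => blaschke3_coeff a n * z ^ n) 4)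
    - (- a * z ^ 3) * (l - csum (fun n => blaschke3_coeff a n * z ^ n) 1)
    + csum (fun n => blaschke3_coeff a n * z ^ n) 4
    + a * z ^ 3 * csum (fun n => blaschke3_coeff a n * z ^ n) 1)%C; [ring|].
  rewrite E. simpl. rewrite RtoC_minus, !RtoC_mult. ring.
Qed.

Lemma derived_extremal_coeff (a : R) (n : nat) :
  derived (fun n => RtoC (extremal_coeff a n)) n = RtoC (blaschke3_coeff a n).
Proof.
  unfold derived, extremal_coeff. rewrite <- RtoC_mult. f_equal. field.
  apply not_0_INR. lia.
Qed.

Lemma derived_extremal_expansion (a : R) (Ha : 0 <= a <= 1) (z : C) :
  unit_disc z ->
  is_Cpseries (derived (fun n => RtoC (extremal_coeff a n))) z (blaschke3 a z).
Proof.
  intros Hz. eapply is_series_ext; [|apply (blaschke3_expansion a Ha z Hz)].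
  intros n. simpl. now rewrite derived_extremal_coeff.
Qed.

(** The sum [F] of the integrated series is a primitive of the integrand by termwise
    differentiation, hence equals the integral along the segment. *)
Lemma extremal_expansion (a : R) (Ha : 0 <= a <= 1) (z : C) :
  unit_disc z ->
  is_Cpseries (fun n => RtoC (extremal_coeff a n)) z (extremal a z).
Proof.
  set (c := fun n => RtoC (extremal_coeff a n)).
  set (F := (fun z => @iota C_CompleteNormedModule (is_Cpseries c z)) : C -> C).
  assert (HF : forall w, unit_disc w -> is_Cpseries c w (F w)).
  { intros w Hw. apply (@iota_correct C_AbsRing C_CompleteNormedModule).
    assert (Hb : forall n, Cmod (c n) <= 1)
      by (intros n; unfold c; rewrite Cmod_R; apply (extremal_coeff_bound a Ha)).
    destruct (bounded_coeffs_converge c Hb w Hw) as [l Hl].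
    exists l. split; [exact Hl|]. intros l' Hl'.
    exact (is_Cseries_unique _ _ _ Hl Hl'). }
  assert (HdF : forall w, unit_disc w -> is_Cderive F w (blaschke3 a w)).
  { intros w Hw. apply (is_Cderive_pseries c F w _ HF Hw).
    now apply (derived_extremal_expansion a Ha). }
  assert (Hdg : forall w, unit_disc w -> exists l, is_Cderive (blaschke3 a) w l).
  { intros w Hw.
    destruct (derived_converges (fun n => RtoC (blaschke3_coeff a n))
      (fun w Hw => ex_intro _ _ (blaschke3_expansion a Ha w Hw)) w Hw) as [l Hl].
    exists l. exact (is_Cderive_pseries _ _ w l (blaschke3_expansion a Ha) Hw Hl). }
  intros Hz.
  change (extremal a z) with (segment_integral (blaschke3 a) z).
  rewrite (segment_integral_primitive F _ z HdF Hdg Hz).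
  assert (H0 : F (RtoC 0) = RtoC 0).
  { assert (U0 : unit_disc (RtoC 0)) by (unfold unit_disc; rewrite Cmod_0; lra).
    exact (is_Cseries_unique _ _ _ (HF _ U0)
             (@is_pseries_0 C_AbsRing C_NormedModule c)). }
  replace (F z - F 0)%C with (F z) by (rewrite H0; ring).
  now apply HF.
Qed.

Lemma is_Cderive_extremal (a : R) (Ha : 0 <= a <= 1) (z : C) :
  unit_disc z -> is_Cderive (extremal a) z (blaschke3 a z).
Proof.
  intros Hz. apply (is_Cderive_pseries _ _ _ _ (extremal_expansion a Ha) Hz).
  now apply (derived_extremal_expansion a Ha).
Qed.

(** * The sharp coefficient inequality *)

Theorem theorem5 :
  (forall (omega : C -> C) (c : nat -> C),
     class_B0' omega -> has_expansion omega c ->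
     Cmod (c 4%nat - c 2%nat ^ 2)%C <= 1 / 4 * (1 - Cmod (c 1%nat) ^ 2)) /\
  (forall a : R, 0 <= a <= 1 ->
     class_B0' (extremal a) /\
     exists c : nat -> C,
       has_expansion (extremal a) c /\
       c 1%nat = RtoC a /\
       c 2%nat = RtoC 0 /\
       c 3%nat = RtoC 0 /\
       c 4%nat = RtoC (1 / 4 * (1 - a ^ 2)) /\
       c 5%nat = RtoC 0 /\
       c 6%nat = RtoC 0 /\
       c 7%nat = RtoC (- (1 / 7 * a * (1 - a ^ 2))) /\
       Cmod (c 1%nat) = a /\
       Cmod (c 4%nat - c 2%nat ^ 2)%C = 1 / 4 * (1 - Cmod (c 1%nat) ^ 2)).
Proof.
  split.
  - intros omega c (_ & _ & Hbound) [_ Hc].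
    assert (Hder : forall z, unit_disc z ->
              is_Cpseries (derived c) z (C_derive omega z)).
    { intros z Hz.
      destruct (derived_converges c (fun w Hw => ex_intro _ _ (Hc w Hw)) z Hz) as [g Hg].
      assert (Hd := is_Cderive_pseries c omega z g Hc Hz Hg).
      now rewrite (is_C_derive_unique _ _ _ Hd). }
    assert (H := bounded_function_coeffs (derived c) (C_derive omega) Hder Hbound).
    unfold derived in H. rewrite !Cmod_mult, !Cmod_R, !(Rabs_pos_eq _ (pos_INR _)) in H.
    assert (Htri : Cmod (c 4%nat - c 2%nat ^ 2)%C <= Cmod (c 4%nat) + Cmod (c 2%nat) ^ 2).
    { rewrite <- Cmod_pow, <- (Cmod_opp (c 2%nat ^ 2)). apply Cmod_triangle. }
    simpl INR in H. lra.
  - intros a Ha.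
    assert (Hexp : has_expansion (extremal a) (fun n => RtoC (extremal_coeff a n))).
    { split; [reflexivity|]. exact (extremal_expansion a Ha). }
    split; [split; [|split]|].
    + intros z Hz. exists (blaschke3 a z). now apply is_Cderive_extremal.
    + eexists. exact Hexp.
    + intros z Hz. rewrite (is_C_derive_unique _ _ _ (is_Cderive_extremal a Ha z Hz)).
      now apply blaschke3_bound.
    + exists (fun n => RtoC (extremal_coeff a n)).
      assert (E1 : extremal_coeff a 1 = a) by (unfold extremal_coeff; simpl; field).
      assert (E2 : extremal_coeff a 2 = 0) by (unfold extremal_coeff; simpl; field).
      assert (E4 : extremal_coeff a 4 = 1 / 4 * (1 - a ^ 2))
        by (unfold extremal_coeff; simpl; field).
      repeat split; try (exact (proj2 Hexp)); try (f_equal; unfold extremal_coeff; simpl; field).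
      * rewrite E1, Cmod_R, Rabs_pos_eq; lra.
      * rewrite E1, E2, E4, <- RtoC_pow, <- RtoC_minus, !Cmod_R, !Rabs_pos_eq; nra.
Qed.
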